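(* Let $K$ be a field, let $t\geq 1$ be an integer, and let $x_1,\dots,x_t,y_1,\dots,y_t$ be pairwise distinct indeterminates over $K$. In the polynomial ring $R=K[x_1,\dots,x_t,y_1,\dots,y_t]$ consider the ideal $$I=(x_1,\dots,x_t)\cap(y_1,x_2,\dots,x_t)\cap\cdots\cap(y_1,\dots,y_{t-1},x_t)\cap(y_1,\dots,y_t),$$ that is, $I=\bigcap_{i=0}^{t}(y_1,\dots,y_i,x_{i+1},\dots,x_t)$. Then $I$ is a set-theoretic complete intersection.
   Context: Elements $\gamma_1,\dots,\gamma_r\in R$ generate an ideal $I$ of $R$ up to radical if $\sqrt{I}=\sqrt{(\gamma_1,\dots,\gamma_r)}$. The smallest $r$ for which such elements exist is the arithmetical rank of $I$, denoted $\operatorname{ara} I$. One always has $\operatorname{height} I\leq\operatorname{ara} I$; the ideal $I$ is called a set-theoretic complete intersection if $\operatorname{height} I=\operatorname{ara} I$. *)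

(* Defs.v *)
From HB Require Import structures.
From mathcomp Require Import all_boot all_order all_algebra.
From mathcomp Require Import mpoly.

Set Implicit Arguments.
Unset Strict Implicit.
Unset Printing Implicit Defensive.

Import GRing.Theory.
Local Open Scope ring_scope.

(* Ideals are Prop-valued predicates: no decidability of membership is
   assumed, and the unit ideal is allowed (unlike [idealr_closed]). *)
Definition is_ideal (R : comNzRingType) (I : R -> Prop) : Prop :=
  I 0 /\ forall a u v : R, I u -> I v -> I (a * u + v).

Definition is_prime_ideal (R : comNzRingType) (P : R -> Prop) : Prop :=
  [/\ is_ideal P, ~ P 1 & forall u v : R, P (u * v) -> P u \/ P v].

Definition ideal_sub (R : comNzRingType) (I J : R -> Prop) : Prop :=
  forall f : R, I f -> J f.

Definition ideal_eq (R : comNzRingType) (I J : R -> Prop) : Prop :=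
  forall f : R, I f <-> J f.

Definition ideal_proper_sub (R : comNzRingType) (I J : R -> Prop) : Prop :=
  ideal_sub I J /\ exists f : R, J f /\ ~ I f.

Definition ideal_gen (R : comNzRingType) (r : nat) (g : 'I_r -> R) :
    R -> Prop :=
  fun f => exists c : 'I_r -> R, f = \sum_(j < r) c j * g j.

Definition radical (R : comNzRingType) (I : R -> Prop) : R -> Prop :=
  fun f => exists n : nat, I (f ^+ n).

(* [c 0], ..., [c n] is a strictly ascending chain of n + 1 primes (so of
   length n) ending at P; the values of [c] beyond n are irrelevant. *)
Definition prime_chain (R : comNzRingType) (n : nat) (c : nat -> R -> Prop)
    (P : R -> Prop) : Prop :=
  [/\ forall i : nat, (i <= n)%N -> is_prime_ideal (c i),
      forall i : nat, (i < n)%N -> ideal_proper_sub (c i) (c i.+1)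
    & ideal_eq (c n) P].

(* Heights are given as relations to natural numbers, as a height may be
   infinite. *)
Definition prime_height (R : comNzRingType) (P : R -> Prop) (h : nat) : Prop :=
  (exists c : nat -> R -> Prop, prime_chain h c P) /\
  forall (n : nat) (c : nat -> R -> Prop), prime_chain n c P -> (n <= h)%N.

(* The minimum of the heights of the primes containing I; primes of infinite
   height do not affect it once some prime over I has finite height. *)
Definition ideal_height (R : comNzRingType) (I : R -> Prop) (h : nat) : Prop :=
  (exists P : R -> Prop,
     [/\ is_prime_ideal P, ideal_sub I P & prime_height P h]) /\
  forall (P : R -> Prop) (m : nat),
    is_prime_ideal P -> ideal_sub I P -> prime_height P m -> (h <= m)%N.

Definition generates_up_to_radical (R : comNzRingType) (r : nat)
    (g : 'I_r -> R) (I : R -> Prop) : Prop :=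
  ideal_eq (radical I) (radical (ideal_gen g)).

Definition arithmetical_rank (R : comNzRingType) (I : R -> Prop) (r : nat) :
    Prop :=
  (exists g : 'I_r -> R, generates_up_to_radical g I) /\
  forall (s : nat) (g : 'I_s -> R), generates_up_to_radical g I -> (r <= s)%N.

Definition set_theoretic_complete_intersection (R : comNzRingType)
    (I : R -> Prop) : Prop :=
  is_ideal I /\
  exists h : nat, ideal_height I h /\ arithmetical_rank I h.

(* K[x_1, ..., x_t, y_1, ..., y_t]; indices are shifted by one, so that
   [xvar K j] is x_(j+1) and [yvar K j] is y_(j+1). *)
Definition xvar (K : fieldType) (t : nat) (j : 'I_t) : {mpoly K[t + t]} :=
  'X_(lshift t j).

Definition yvar (K : fieldType) (t : nat) (j : 'I_t) : {mpoly K[t + t]} :=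
  'X_(rshift t j).

(* The generators y_1, ..., y_i, x_(i+1), ..., x_t. *)
Definition mixed_gens (K : fieldType) (t : nat) (i : 'I_t.+1) (j : 'I_t) :
    {mpoly K[t + t]} :=
  if (j < i)%N then yvar K j else xvar K j.

Definition mixed_intersection (K : fieldType) (t : nat) :
    {mpoly K[t + t]} -> Prop :=
  fun f => forall i : 'I_t.+1, ideal_gen (mixed_gens K i) f.

(* Main.v *)
Require Import Defs.
From mathcomp Require Import all_boot all_order all_algebra.
From mathcomp Require Import mpoly.
From mathcomp Require Import zify ring.

(** Write x_1, ..., x_t, y_1, ..., y_t for the variables.  The ideal I has,
    up to radical, the generators x_j y_k with k <= j; both its height and its
    arithmetical rank equal t.

    Upper bound for the rank (the Schmitt-Vogel argument).  Arrange the
    products x_j y_k, k <= j, along the t diagonals j - k = d and let q_d be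
    the sum over the d-th one.  Two distinct products x_j y_k and x_j' y_k' of
    one diagonal, with j < j', satisfy k < k', so that their product is
    divisible by x_j' y_k, which lies on a longer diagonal.  Descending on d,
    the square of x_j y_k is, modulo products already treated, a multiple of
    q_d; hence q_0, ..., q_(t-1) generate I up to radical
    ([diagonal_sums_generate]).

    Lower bound for the rank.  If g_1, ..., g_s generate I up to radical, put
    all y_j equal to 1: the g_i become polynomials without constant term in
    x_1, ..., x_t, because I lies in (x_1, ..., x_t), and their ideal contains
    a power of every x_j, because x_j y_j is in I.  Then K[x] is spanned,
    modulo polynomials of order at least k, by k^s N^t products of powers,
    whereas k can be taken linear in M so that this quotient has dimension at
    least M^t; letting M grow gives t <= s ([num_gens_irrelevant_ge]).

    Height.  A prime containing I contains all the generators of one of the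
    intersected ideals ([prime_over_mixed]), each of which is generated by t
    variables.  It remains to see that the prime generated by a set of t
    variables has height exactly t ([var_ideal_height]).  Adding variables one
    at a time produces the chains, and also extends a chain of length n ending
    at that prime to a chain of length n + t in the ring of 2t variables; so
    it suffices that chains of primes in a polynomial ring are no longer than
    the number of variables ([prime_chain_length_le]).  This is a counting
    argument again: elements chosen in the successive steps of a chain are
    algebraically independent ([chain_independent]), and m + 1 polynomials in
    m variables have too many products of powers in too low degrees for
    that. *)

Set Implicit Arguments.
Unset Strict Implicit.
Unset Printing Implicit Defensive.

Import GRing.Theory.
Local Open Scope ring_scope.

(** * Ideals and radicals *)

Section Ideals.
Variable R : comNzRingType.
Implicit Types (I J P : R -> Prop) (f g u v : R).

Lemma idealD J u v : is_ideal J -> J u -> J v -> J (u + v).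
Proof. by move=> [_ HJ] Ju Jv; rewrite -[u]mul1r; apply: HJ. Qed.

Lemma idealMl J u v : is_ideal J -> J v -> J (u * v).
Proof. by move=> [J0 HJ] Jv; rewrite -[_ * _]addr0; apply: HJ. Qed.

Lemma idealB J u v : is_ideal J -> J u -> J v -> J (u - v).
Proof.
by move=> HJ Ju Jv; rewrite -mulN1r; apply: idealD => //; apply: idealMl.
Qed.

Lemma ideal_sum J (T : finType) (Q : pred T) (F : T -> R) :
  is_ideal J -> (forall i, Q i -> J (F i)) -> J (\sum_(i | Q i) F i).
Proof.
by move=> HJ JF; apply: big_ind => //; [case: HJ|move=> u v; apply: idealD].
Qed.

Lemma ideal_exp_mul J f n m : is_ideal J -> (n <= m)%N -> J (f ^+ n) ->
  J (f ^+ m).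
Proof. by move=> HJ le_nm Jf; rewrite -(subnK le_nm) exprD; apply: idealMl. Qed.

Lemma ideal_gen_is_ideal r (g : 'I_r -> R) : is_ideal (ideal_gen g).
Proof.
split; first by exists (fun=> 0); rewrite big1 // => j _; rewrite mul0r.
move=> a _ _ [c ->] [d ->]; exists (fun j => a * c j + d j).
by rewrite mulr_sumr -big_split; apply: eq_bigr => j _; rewrite mulrDl mulrA.
Qed.

Lemma ideal_gen_min r (g : 'I_r -> R) J : is_ideal J ->
  (forall j, J (g j)) -> ideal_sub (ideal_gen g) J.
Proof.
by move=> HJ Jg _ [c ->]; apply: ideal_sum => // j _; apply: idealMl.
Qed.

Lemma mem_ideal_gen r (g : 'I_r -> R) j : ideal_gen g (g j).
Proof.
exists (fun i => (i == j)%:R); rewrite (bigD1 j) //= eqxx mul1r big1 ?addr0 //.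
by move=> i /negPf ->; rewrite mul0r.
Qed.

Lemma sub_radical I : ideal_sub I (radical I).
Proof. by move=> f If; exists 1%N; rewrite expr1. Qed.

Lemma radical_mono I J : ideal_sub I J -> ideal_sub (radical I) (radical J).
Proof. by move=> IJ f [n In]; exists n; apply: IJ. Qed.

Lemma radical_idem I f n : radical I (f ^+ n) -> radical I f.
Proof. by move=> [m Ifm]; exists (n * m)%N; rewrite exprM. Qed.

(** In the binomial expansion of (a u + v) ^ (n + m), every term contains u ^ n
    or v ^ m. *)
Lemma radical_is_ideal I : is_ideal I -> is_ideal (radical I).
Proof.
move=> HI; split; first by exists 1%N; rewrite expr1; case: HI.
move=> a u v [n Iu] [m Iv]; exists (n + m)%N; rewrite exprDn.
apply: ideal_sum => // i _; rewrite -mulr_natl; apply: idealMl => //.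
have [le_mi|lt_im] := leqP m i.
  by apply: idealMl => //; apply: ideal_exp_mul Iv.
rewrite mulrC; apply: idealMl => //; rewrite exprMn; apply: idealMl => //.
by apply: ideal_exp_mul Iu => //; lia.
Qed.

End Ideals.

(** * Chains of primes *)

Section Chains.
Variable R : comNzRingType.
Implicit Types (P Q : R -> Prop).

(** Enlarging the last prime keeps the inclusions of the chain strict; this
    transports lower bounds of heights to larger primes. *)
Lemma prime_chain_replace_last n (c : nat -> R -> Prop) P Q :
    prime_chain n c Q -> is_prime_ideal P -> ideal_sub Q P ->
  prime_chain n (fun i => if (i < n)%N then c i else P) P.
Proof.
move=> [cprime clt cQ] HP QP; split=> [i le_in|i lt_in|f] //.
- by case: ifP => // _; apply: cprime.
- rewrite lt_in; case: ifP => [_|]; first exact: clt.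
  rewrite ltn_neqAle lt_in andbT => /eqP i1n.
  have [ci [f [cf nf]]] := clt i lt_in; rewrite i1n in ci cf.
  by split=> [g /ci/cQ/QP //|]; exists f; split=> //; apply/QP/cQ.
- by rewrite ltnn.
Qed.

Lemma prime_chain_extend n (c : nat -> R -> Prop) P Q :
    prime_chain n c Q -> is_prime_ideal P -> ideal_proper_sub Q P ->
  prime_chain n.+1 (fun i => if (i <= n)%N then c i else P) P.
Proof.
move=> [cprime clt cQ] HP [QP [f [Pf Qf]]]; split=> [i le_in|i|g] //.
- by case: ifP => // /cprime.
- rewrite ltnS => le_in; rewrite le_in.
  case: ltnP => [|le_ni]; first exact: clt.
  have -> : i = n by apply/eqP; rewrite eqn_leq le_in.
  split=> [g /cQ/QP //|].
  by exists f; split=> // /cQ.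
- by rewrite ltnn.
Qed.

End Chains.

(** * Families of power products *)

Section PowerProducts.
Variables (K : fieldType) (A : comAlgType K).
Implicit Types (I J P Q : A -> Prop) (l gs : seq A) (c : seq K) (f g v : A).

(** Coefficients and vectors are lists rather than indexed families, so that
    the concatenations that build products of powers need no reindexing. *)
Definition lincomb c l : A := \sum_(p <- zip c l) p.1 *: p.2.

Lemma lincomb_nil l : lincomb [::] l = 0.
Proof. by rewrite /lincomb; case: l => *; rewrite big_nil. Qed.

Lemma lincomb_cat c1 c2 l1 l2 : size c1 = size l1 ->
  lincomb (c1 ++ c2) (l1 ++ l2) = lincomb c1 l1 + lincomb c2 l2.
Proof. by move=> eq_sz; rewrite /lincomb zip_cat // big_cat. Qed.

Lemma lincomb_map_mul c g l : lincomb c (map ( *%R g) l) = g * lincomb c l.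
Proof.
elim: l c => [|v l IHl] [|a c]; rewrite /lincomb /= ?big_nil ?mulr0 //.
by rewrite !big_cons mulrDr /= scalerAr; congr (_ + _); apply: IHl.
Qed.

Lemma lincombE c l : size c = size l ->
  lincomb c l = \sum_(i < size l) c`_i *: l`_i.
Proof.
move=> eq_sz; rewrite /lincomb (big_nth (0, 0)) size_zip eq_sz minnn big_mkord.
by apply: eq_bigr => i _; rewrite nth_zip.
Qed.

Fixpoint pows k g l : seq A :=
  if k is k'.+1 then l ++ map ( *%R g) (pows k' g l) else [::].

(** The products g_1^e_1 ... g_r^e_r v with all e_i < k and v in l. *)
Definition power_products k gs l := foldr (pows k) l gs.

Lemma size_pows k g l : size (pows k g l) = (k * size l)%N.
Proof. by elim: k => //= k IHk; rewrite size_cat size_map IHk mulSn. Qed.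

Lemma size_power_products k gs l :
  size (power_products k gs l) = (k ^ size gs * size l)%N.
Proof.
by elim: gs => [|g gs IH] /=; rewrite ?mul1n // size_pows IH expnS mulnA.
Qed.

(** For l = [power_products k gs [:: 1]] and all k, this says that gs is
    algebraically independent over K in the quotient by Q. *)
Definition independent_mod Q l :=
  forall c, size c = size l -> Q (lincomb c l) -> c = nseq (size l) 0.

Definition spans_mod J l :=
  forall f, exists2 c, size c = size l & J (f - lincomb c l).

(** A relation modulo P is u + g w with u in the span of l.  Read modulo Q, it
    makes u a trivial combination; then g w, hence w, lies in the prime P, and
    w involves fewer powers of g. *)
Lemma pows_independent P Q g l k :
    is_ideal Q -> is_prime_ideal P -> ideal_sub P Q -> Q g -> ~ P g ->
  independent_mod Q l -> independent_mod P (pows k g l).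
Proof.
move=> HQ [HP _ PM] PQ Qg Pg indl; elim: k => [|k IHk] c /=.
  by move/size0nil=> ->.
rewrite size_cat size_map => eq_sz Pc.
pose c1 := take (size l) c; pose c2 := drop (size l) c.
have sz1 : size c1 = size l by rewrite size_takel ?eq_sz ?leq_addr.
have sz2 : size c2 = size (pows k g l) by rewrite size_drop eq_sz addKn.
move: Pc; rewrite -(cat_take_drop (size l) c) lincomb_cat // lincomb_map_mul.
move=> Pc; have c1E : c1 = nseq (size l) 0.
  apply: indl => //.
  rewrite -[lincomb _ _](addrK (g * lincomb c2 (pows k g l))).
  by apply: idealB => //; [apply: PQ|rewrite mulrC; apply: idealMl].
have lc0 : lincomb c1 l = 0.
  rewrite lincombE // c1E big1 // => i _.
  by rewrite nth_nseq ltn_ord scale0r.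
have {}Pc : P (g * lincomb c2 (pows k g l)) by move: Pc; rewrite -/c1 lc0 add0r.
case: (PM _ _ Pc) => // /(IHk _ sz2) c2E.
by rewrite -/c1 -/c2 c1E c2E cat_nseq /ncons -iterD /nseq /ncons.
Qed.

(** Every strict inclusion of the chain provides one more independent
    element: this replaces the drop of the transcendence degree along strict
    inclusions of primes. *)
Lemma chain_independent n (c : nat -> A -> Prop) P l :
    prime_chain n c P -> independent_mod P l ->
  exists2 gs, size gs = n &
    forall k, independent_mod (c 0) (power_products k gs l).
Proof.
elim: n c => [|n IHn] c [cprime clt cP] indl.
  by exists [::] => // k b sz_b /cP; apply: indl.
have /IHn[] // : prime_chain n (fun i => c i.+1) P.
  by split=> // i ltin; [apply: cprime|apply: clt].
move=> gs sz_gs ind_gs; have [c01 [g [c1g c0g]]] := clt 0 isT.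
exists (g :: gs) => [|k] /=; first by rewrite sz_gs.
by apply: (pows_independent _ (cprime 0 _) c01) => //; case: (cprime 1).
Qed.

(** The ideal sum J + (g). *)
Definition add_gen J g : A -> Prop := fun f => exists h, J (f - h * g).

Lemma add_gen_is_ideal J g : is_ideal J -> is_ideal (add_gen J g).
Proof.
move=> HJ; split; first by exists 0; rewrite mul0r subr0; case: HJ.
move=> a u v [h Ju] [h' Jv]; exists (a * h + h').
have -> : a * u + v - (a * h + h') * g = a * (u - h * g) + (v - h' * g) by ring.
by case: HJ => _; apply.
Qed.

Lemma pows_spans J g l k : is_ideal J -> J (g ^+ k) ->
  spans_mod (add_gen J g) l -> spans_mod J (pows k g l).
Proof.
move=> HJ Jgk spl.
(* Expanding the coefficient of g again and again gives an expansion in powers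
   of g; the remainder disappears at j = k. *)
have step j f : exists2 c, size c = size (pows j g l) &
    exists h, J (f - lincomb c (pows j g l) - h * g ^+ j).
  elim: j f => [|j IHj] f /=.
    exists [::] => //; exists f; rewrite lincomb_nil expr0 mulr1 subr0 subrr.
    by case: HJ.
  have [c1 sz1 [h Jh]] := spl f; have [c2 sz2 [h' Jh']] := IHj h.
  exists (c1 ++ c2); first by rewrite !size_cat size_map sz1 sz2.
  exists h'; rewrite lincomb_cat // lincomb_map_mul exprS.
  set a := lincomb c1 l in Jh *; set b := lincomb c2 _ in Jh' *.
  have -> : f - (a + g * b) - h' * (g * g ^+ j) =
            f - a - h * g + g * (h - b - h' * g ^+ j) by ring.
  by apply: idealD => //; apply: idealMl.
move=> f; have [c sz_c [h Jh]] := step k f; exists c => //.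
rewrite -[_ - _](subrK (h * g ^+ k)).
by apply: idealD => //; apply: idealMl.
Qed.

(** The hypothesis on all larger ideals J' containing gs expresses that l spans
    modulo J + (gs).  In this form it passes from J to J + (g), so that the
    generators can be replaced by their powers one by one. *)
Lemma power_products_spans gs l k J : is_ideal J ->
    (forall J', is_ideal J' -> ideal_sub J J' -> {in gs, forall g, J' g} ->
       spans_mod J' l) ->
    {in gs, forall g, J (g ^+ k)} ->
  spans_mod J (power_products k gs l).
Proof.
elim: gs J => [|g gs IH] J HJ spl Jgs /=; first by apply: spl.
apply: pows_spans => //; first by apply: Jgs; rewrite mem_head.
have sJ : ideal_sub J (add_gen J g).
  by move=> f Jf; exists 0; rewrite mul0r subr0.
apply: IH; first exact: add_gen_is_ideal.
- move=> J' HJ' JJ' J'gs; apply: spl => // [f Jf|f].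
    exact/JJ'/sJ.
  rewrite inE => /predU1P[->|/J'gs //]; apply: JJ'; exists 1.
  by rewrite mul1r subrr; case: HJ.
- by move=> f gsf; apply/sJ/Jgs; rewrite inE gsf orbT.
Qed.

(** * Counting with linear algebra *)

(** A matrix with a left inverse has at least as many rows as columns: the
    combinations give the left inverse of the matrix of coordinates of l. *)
Lemma card_le_size_spanning (T : finType) (phi : T -> {linear A -> K | *%R}) l :
    (forall i, exists2 c, size c = size l &
       forall j, phi j (lincomb c l) = (i == j)%:R) ->
  (#|T| <= size l)%N.
Proof.
move=> dual; have [c szc cE] := fin_all_exists2 dual.
pose C := \matrix_(i < #|T|, s < size l) (c (enum_val i))`_s.
pose V := \matrix_(s < size l, j < #|T|) phi (enum_val j) l`_s.
apply: (@mulmx1_min K _ _ C V); apply/matrixP=> i j; rewrite !mxE.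
have := cE (enum_val i) (enum_val j).
rewrite lincombE // linear_sum (inj_eq enum_val_inj) => <-.
by apply: eq_bigr => s _; rewrite !mxE linearZ.
Qed.

Lemma size_independent_le_card (T : finType) (phi : T -> {linear A -> K | *%R})
    l :
    (forall c, size c = size l -> (forall j, phi j (lincomb c l) = 0) ->
       c = nseq (size l) 0) ->
  (size l <= #|T|)%N.
Proof.
move=> ind; rewrite leqNgt; apply/negP => lt_Tl.
pose V := \matrix_(s < size l, j < #|T|) phi (enum_val j) l`_s.
have : kermx V != 0.
  rewrite -mxrank_eq0 mxrank_ker -lt0n subn_gt0.
  by rewrite (leq_ltn_trans _ lt_Tl) // rank_leq_col.
case/rowV0Pn=> u /sub_kermxP uV0 /eqP[]; apply/rowP=> s; rewrite mxE.
pose c := mkseq (fun i => oapp (u 0) 0 (insub i)) (size l).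
have cE (i : 'I_(size l)) : c`_i = u 0 i by rewrite nth_mkseq ?valK.
have szc : size c = size l by rewrite size_mkseq.
rewrite -(cE s) (ind c) ?nth_nseq ?ltn_ord // => j.
rewrite lincombE // linear_sum -(enum_rankK j).
move/rowP/(_ (enum_rank j)): uV0; rewrite !mxE => uV0; rewrite -[RHS]uV0.
by apply: eq_bigr => i _; rewrite !mxE linearZ /= cE.
Qed.

End PowerProducts.

(** With base C + 1, the factor C is smaller than one more power. *)
Lemma growth_exponent_le (r m C : nat) :
  (forall k, (k.+1 ^ r <= C * k.+1 ^ m)%N) -> (r <= m)%N.
Proof.
move=> bnd; rewrite leqNgt; apply/negP => lt_mr.
have := bnd C; rewrite leqNgt => /negP; apply.
rewrite -(subnKC lt_mr) expnD expnS.
rewrite (@leq_trans (C.+1 * C.+1 ^ m)) ?ltn_pmul2r ?expn_gt0 //.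
by rewrite leq_pmulr // expn_gt0.
Qed.

(** * Degrees and orders of polynomials *)

Section Polynomials.
Variables (K : fieldType) (n : nat).
Local Notation R := {mpoly K[n]}.
Implicit Types (J P : R -> Prop) (f g : R) (S : {set 'I_n}).

Definition degree_le d f := forall m, (d < mdeg m)%N -> f@_m = 0.

Definition order_ge k f := forall m, (mdeg m < k)%N -> f@_m = 0.

Lemma mcoeffM_eq0 f g m :
  (forall m1 m2, m = (m1 + m2)%MM -> f@_m1 = 0 \/ g@_m2 = 0) ->
  (f * g)@_m = 0.
Proof.
move=> fg0; rewrite mcoeffM big1 // => k /eqP mE.
by case: (fg0 _ _ mE) => ->; rewrite ?mul0r ?mulr0.
Qed.

Lemma degree_leM d e f g :
  degree_le d f -> degree_le e g -> degree_le (d + e) (f * g).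
Proof.
move=> df eg m dm; apply: mcoeffM_eq0 => m1 m2 mE; rewrite mE mdegD in dm.
have [lt_d|le_d] := ltnP d (mdeg m1); first by left; apply: df.
by right; apply: eg; lia.
Qed.

Lemma degree_leW d e f : (d <= e)%N -> degree_le d f -> degree_le e f.
Proof. by move=> le_de df m /(leq_ltn_trans le_de); apply: df. Qed.

Lemma degree_le_msize f : degree_le (msize f) f.
Proof. by move=> m /ltnW/msize_mdeg_ge; rewrite -mcoeff_eq0 => /eqP. Qed.

Lemma degree_le_lincomb d c (l : seq R) :
  {in l, forall v, degree_le d v} -> degree_le d (lincomb c l).
Proof.
elim: l c => [|v l IHl] [|a c] dl m dm;
  rewrite /lincomb /= ?big_nil ?mcoeff0 // big_cons mcoeffD mcoeffZ /=.
rewrite dl ?mem_head // mulr0 add0r; apply: IHl dm => w lw.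
by apply: dl; rewrite inE lw orbT.
Qed.

Lemma degree_le_power_products D k gs :
    {in gs, forall g, degree_le D g} ->
  {in power_products k gs [:: 1], forall v : R,
     degree_le (size gs * (k * D)) v}.
Proof.
elim: gs => [|g gs IH] dgs v /=.
  rewrite inE => /eqP-> m dm; rewrite mcoeff1; case: eqP => // m0.
  by rewrite m0 mdeg0 in dm.
have {}IH : {in power_products k gs [:: 1], forall v : R,
     degree_le (size gs * (k * D)) v}.
  by apply: IH => w gsw; apply: dgs; rewrite inE gsw orbT.
have dg := dgs g (mem_head _ _).
have step j w : w \in pows j g (power_products k gs [:: 1]) ->
    degree_le (j * D + size gs * (k * D)) w.
  elim: j w => //= j IHj w; rewrite mem_cat => /orP[/IH|/mapP[u /IHj du ->]].
    by apply: degree_leW; rewrite leq_addl.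
  by rewrite mulSn -addnA; apply: degree_leM.
by rewrite mulSn; apply: step.
Qed.

Lemma order_geM k e f g :
  order_ge k f -> order_ge e g -> order_ge (k + e) (f * g).
Proof.
move=> kf eg m km; apply: mcoeffM_eq0 => m1 m2 mE; rewrite mE mdegD in km.
have [lt_k|le_k] := ltnP (mdeg m1) k; first by left; apply: kf.
by right; apply: eg; lia.
Qed.

Lemma order_geX g k : g@_0 = 0 -> order_ge k (g ^+ k).
Proof.
move=> g0; elim: k => [|k IHk] //.
rewrite exprS -add1n; apply: order_geM => //.
by move=> m; rewrite ltnS leqn0 mdeg_eq0 => /eqP->.
Qed.

Lemma order_ge_is_ideal k : is_ideal (order_ge k).
Proof.
split=> [m _|a u v ku kv m km]; first by rewrite mcoeff0.
rewrite mcoeffD kv // addr0 (@order_geM 0 k) //; by move=> ?.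
Qed.

(** Monomials with all exponents below M: unlike those of bounded total degree,
    they are counted by a plain power. *)
Definition box_monom M (a : {ffun 'I_n -> 'I_M}) : 'X_{1..n} :=
  [multinom (a i : nat) | i < n].

Lemma box_monom_inj M : injective (@box_monom M).
Proof.
by move=> a b /mnmP eq_ab; apply/ffunP => i; apply: val_inj; have := eq_ab i;
  rewrite !mnmE.
Qed.

Lemma mdeg_box_monom M (a : {ffun 'I_n -> 'I_M}) :
  (0 < n)%N -> (mdeg (box_monom a) < n * M)%N.
Proof.
move=> n_gt0; rewrite mdegE; under eq_bigr do rewrite mnmE.
have M_gt0 : (0 < M)%N by case: (a (Ordinal n_gt0)) => i; apply: leq_trans.
apply: (@leq_ltn_trans (\sum_(i < n) M.-1)).
  by apply: leq_sum => i _; have := ltn_ord (a i); lia.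
by rewrite sum_nat_const card_ord ltn_pmul2l // prednK.
Qed.

Lemma mnm_le_mdeg (m : 'X_{1..n}) i : (m i <= mdeg m)%N.
Proof. by rewrite mdegE (bigD1 i) //= leq_addr. Qed.

Lemma ideal_monom J (m : 'X_{1..n}) i :
  is_ideal J -> J 'X_i -> m i != 0%N -> J 'X_[m].
Proof.
move=> HJ Ji mi; have le_im : (U_(i) <= m)%MM.
  by apply/mnm_lepP => j; rewrite mnm1E; case: eqP => [<-|//]; rewrite lt0n.
by rewrite -(submK le_im) mpolyXD; apply: idealMl.
Qed.

Lemma sub_constant_mem J f : is_ideal J -> (forall i, J 'X_i) ->
  J (f - f@_0 *: 1).
Proof.
move=> HJ JX; elim/mpolyind: f => [|c m p _ _ IHp].
  by rewrite mcoeff0 scale0r subr0; case: HJ.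
rewrite mcoeffD mcoeffZ mcoeffX scalerDl opprD addrACA; apply: idealD => //.
have [->|/eqP m0] := eqVneq m 0%MM; first by rewrite mpolyX0 mulr1 subrr;
  case: HJ.
rewrite mulr0 scale0r subr0 -mul_mpolyC; apply: idealMl => //.
have [i mi] : exists i, m i != 0%N.
  apply/existsP; apply/contra_notT: m0 => /existsPn m0; apply/mnmP => i.
  by rewrite mnm0E; apply/eqP/negPn/m0.
exact: ideal_monom mi.
Qed.

(** * Lengths of chains of primes *)

(** A chain of length k yields k polynomials, of degree at most D say, whose
    (j+1)^k products of powers with exponents at most j are independent.  Their
    degrees are at most k (j+1) D, so they live in a space of dimension
    at most (k (j+1) D + 1)^n, which is O((j+1)^n). *)
Lemma prime_chain_length_le k (c : nat -> R -> Prop) P :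
  prime_chain k c P -> (k <= n)%N.
Proof.
move=> chain; have [cprime _ cP] := chain.
have [HP P1 _] := cprime k (leqnn k).
have ind1 : independent_mod P [:: 1].
  move=> [|a []] // _; rewrite /lincomb big_seq1 /= => /cP Pa.
  congr [:: _]; apply/eqP/negPn/negP => a0; apply: P1.
  have -> : 1 = a^-1%:MP * (a *: 1) :> R.
    by rewrite mul_mpolyC scalerA mulVf // scale1r.
  exact: idealMl.
have [gs sz_gs ind_gs] := chain_independent chain ind1.
have [D dgs] : exists D, {in gs, forall g, degree_le D g}.
  exists (\max_(g <- gs) msize g)%N => g gs_g.
  by apply: degree_leW (@degree_le_msize g); apply: leq_bigmax_seq.
apply: (@growth_exponent_le _ _ ((k * D).+1 ^ n)) => j.
set l := power_products j.+1 gs [:: 1].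
have szl : size l = (j.+1 ^ k)%N by rewrite size_power_products sz_gs muln1.
pose T := {ffun 'I_n -> 'I_(k * (j.+1 * D)).+1}.
have : (size l <= #|{: T}|)%N.
  apply: (size_independent_le_card (phi := fun a : T => mcoeff (box_monom a))).
  move=> b szb b0; apply: ind_gs => //.
  suff -> : lincomb b l = 0 by case: (cprime 0 isT) => -[].
  apply/mpolyP => m; rewrite mcoeff0.
  have [le_m|lt_m] := leqP (mdeg m) (k * (j.+1 * D)); last first.
    move: lt_m; rewrite -sz_gs; apply: degree_le_lincomb.
    exact: degree_le_power_products.
  rewrite -(b0 [ffun i => inord (m i)]); congr (_ @_ _).
  apply/mnmP => i; rewrite mnmE ffunE inordK // ltnS.
  exact: leq_trans (mnm_le_mdeg _ _) le_m.
rewrite szl card_ffun !card_ord => /leq_trans; apply.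
rewrite -expnMn; case: (posnP n) => [->|n_gt0]; first by rewrite !expn0.
by rewrite leq_exp2r //; nia.
Qed.

(** * Number of generators up to radical *)

(** Let N be such that the ideal of g contains all 'X_i^N.  Then 1 spans R
    modulo the variables, so the N^n products of powers of the variables span R
    modulo the g j, and their products with powers of the g j below k span R
    modulo all (g j)^k, hence modulo order k.  The M^n monomials of a box have
    order below k = n M, so M^n <= (n M)^s N^n for every M > 0. *)
Lemma num_gens_irrelevant_ge s (g : 'I_s -> R) :
  (forall j, (g j)@_0 = 0) -> (forall i, radical (ideal_gen g) 'X_i) ->
  (n <= s)%N.
Proof.
move=> g0 gX; case: (posnP n) => [->//|n_gt0].
have [N0 XN0] := fin_all_exists gX.
pose N := \max_i N0 i.
have XN i : ideal_gen g ('X_i ^+ N).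
  apply: ideal_exp_mul (XN0 i); last exact: leq_bigmax.
  exact: ideal_gen_is_ideal.
pose Xs : seq R := [seq 'X_i | i <- enum 'I_n].
pose gs := [seq g j | j <- enum 'I_s].
pose l k := power_products k gs (power_products N Xs [:: 1]).
have sz_l k : size (l k) = (k ^ s * N ^ n)%N.
  by rewrite !size_power_products !size_map -!enumT !size_enum_ord muln1.
have spl k : spans_mod (order_ge k) (l k).
  apply: power_products_spans; first exact: order_ge_is_ideal.
    move=> J HJ _ Jg; apply: power_products_spans => // [J' HJ' _ JX|f].
      move=> f; exists [:: f@_0] => //; rewrite /lincomb big_seq1 /=.
      apply: sub_constant_mem => // i; apply: JX.
      by apply: map_f; rewrite mem_enum.
    case/mapP=> i _ ->; apply: (ideal_gen_min HJ _ (XN i)) => j.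
    by apply: Jg; apply: map_f; rewrite mem_enum.
  by move=> f /mapP[j _ ->]; apply: order_geX.
apply: (@growth_exponent_le _ _ (n ^ s * N ^ n)) => M.
pose T := {ffun 'I_n -> 'I_M.+1}.
have : (#|{: T}| <= size (l (n * M.+1)))%N.
  apply: (card_le_size_spanning (phi := fun a : T => mcoeff (box_monom a))).
  move=> a; have [c szc cE] := spl (n * M.+1)%N 'X_[box_monom a].
  exists c => // b; move: (cE _ (mdeg_box_monom b n_gt0)).
  rewrite mcoeffB mcoeffX (inj_eq (@box_monom_inj _)) => /eqP.
  by rewrite subr_eq0 => /eqP/esym.
by rewrite card_ffun !card_ord sz_l expnMn mulnAC.
Qed.

(** * Ideals generated by variables *)

Definition kill_vars S : n.-tuple R :=
  [tuple if i \in S then 0 else 'X_i | i < n].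

(** Membership in the ideal of the variables indexed by S, tested by setting
    these variables to zero; primality is immediate in this form. *)
Definition var_ideal S f : Prop := f \mPo kill_vars S = 0.

Lemma var_ideal_prime S : is_prime_ideal (var_ideal S).
Proof.
rewrite /var_ideal; split.
- split=> [|a u v u0 v0]; first by rewrite comp_mpoly0.
  by rewrite rmorphD rmorphM /= u0 v0 mulr0 addr0.
- by move/eqP; rewrite comp_mpoly1 oner_eq0.
- by move=> u v /eqP; rewrite rmorphM mulf_eq0 => /orP[]/eqP; [left|right].
Qed.

Lemma var_idealX S i : var_ideal S 'X_i <-> i \in S.
Proof.
rewrite /var_ideal comp_mpolyXU -tnth_nth tnth_mktuple; case: ifP => // _.
split=> // /(congr1 (mcoeff U_(i)%MM))/eqP.
by rewrite mcoeffXU eqxx mcoeff0 oner_eq0.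
Qed.

Lemma sub_comp_mpoly_mem J (lq : n.-tuple R) f : is_ideal J ->
  (forall i, J ('X_i - tnth lq i)) -> J (f - (f \mPo lq)).
Proof.
move=> HJ JX; elim/mpolyind: f => [|c m p _ _ IHp].
  by rewrite comp_mpoly0 subr0; case: HJ.
rewrite comp_mpolyD comp_mpolyZ opprD addrACA -scalerBr; apply: idealD => //.
rewrite -mul_mpolyC; apply: idealMl => //; rewrite comp_mpolyX mpolyXE_id.
have JM u v u' v' : J (u - u') -> J (v - v') -> J (u * v - u' * v').
  have -> : u * v - u' * v' = v * (u - u') + u' * (v - v') by ring.
  by move=> Ju Jv; apply: idealD => //; apply: idealMl.
apply: (big_ind2 (fun u v => J (u - v))) => [|u u' v v'|i _].
- by rewrite subrr; case: HJ.
- exact: JM.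
- elim: (m i) => [|k IHk]; first by rewrite !expr0 subrr; case: HJ.
  by rewrite !exprS; apply: JM.
Qed.

Lemma var_ideal_min S J : is_ideal J -> (forall i, i \in S -> J 'X_i) ->
  ideal_sub (var_ideal S) J.
Proof.
move=> HJ JX f f0; rewrite -[f]subr0 -f0; apply: sub_comp_mpoly_mem => // i.
rewrite tnth_mktuple; case: ifP => [/JX|_]; rewrite ?subr0 // subrr.
by case: HJ.
Qed.

Lemma var_ideal_proper S x : x \notin S ->
  ideal_proper_sub (var_ideal S) (var_ideal (x |: S)).
Proof.
move=> Sx; split.
  apply: var_ideal_min => [|i Si]; first by case: (var_ideal_prime (x |: S)).
  by apply/var_idealX; rewrite setU1r.
exists 'X_x; split; first by apply/var_idealX; rewrite setU11.
by move/var_idealX; apply/negP.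
Qed.

Lemma var_ideal_gen S r (v : 'I_r -> 'I_n) : S =i codom v ->
  ideal_eq (ideal_gen (fun j => 'X_(v j))) (var_ideal S).
Proof.
move=> SE f; split.
  apply: ideal_gen_min => [|j]; first by case: (var_ideal_prime S).
  by apply/var_idealX; rewrite SE codom_f.
apply: var_ideal_min => [|i]; first exact: ideal_gen_is_ideal.
rewrite SE => /codomP[j ->].
exact: (mem_ideal_gen (fun j => 'X_(v j) : R)).
Qed.

Lemma var_ideal_chain S :
  exists c : nat -> R -> Prop, prime_chain #|S| c (var_ideal S).
Proof.
elim: {S}_.+1 {-2}S (ltnSn #|S|) => // k IHk S ltSk.
have [->|[x Sx]] := set_0Vmem S.
  exists (fun=> var_ideal set0); rewrite cards0.
  by split=> // *; apply: var_ideal_prime.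
have [|c chain] := IHk (S :\ x).
  by move: ltSk; rewrite (cardsD1 x S) Sx.
have Sxx : x \notin S :\ x by rewrite !inE eqxx.
have := prime_chain_extend chain (var_ideal_prime _) (var_ideal_proper Sxx).
rewrite setD1K // (cardsD1 x S) Sx add1n => chain'.
by eexists; exact: chain'.
Qed.

(** The upper bound is reduced to the length bound of the whole ring by
    prolonging a chain through the variables outside S. *)
Lemma var_ideal_height S : prime_height (var_ideal S) #|S|.
Proof.
split=> [|k c]; first exact: var_ideal_chain.
rewrite -(leq_add2r #|~: S|) cardsC card_ord.
elim: {S}_.+1 {-2}S (ltnSn #|~: S|) k c => // j IHj S ltSj k c chain.
have [S0|[x Sx]] := set_0Vmem (~: S).
  by rewrite S0 cards0 addn0; apply: prime_chain_length_le chain.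
have [nSx SxE] : x \notin S /\ ~: (x |: S) = ~: S :\ x.
  by split; [rewrite inE in Sx|rewrite setCU setIC setDE].
have := prime_chain_extend chain (var_ideal_prime _) (var_ideal_proper nSx).
move/IHj; rewrite SxE [in #|~: S|](cardsD1 x) Sx addnA addn1; apply.
by move: ltSj; rewrite (cardsD1 x (~: S)) Sx.
Qed.

Lemma prime_height_ge_card S P h :
  is_prime_ideal P -> (forall i, i \in S -> P 'X_i) -> prime_height P h ->
  (#|S| <= h)%N.
Proof.
move=> HP PX [_ hP]; have [c chain] := var_ideal_chain S; apply: hP.
apply: (prime_chain_replace_last chain HP).
by apply: var_ideal_min => //; case: HP.
Qed.

End Polynomials.

(** * The ideal of mixed variables *)

(** A constructive substitute for excluded middle on B, as membership in a
    prime need not be decidable. *)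
Lemma finite_or (T : finType) (A : T -> Prop) (B : Prop) :
  (forall j, A j \/ B) -> (forall j, A j) \/ B.
Proof.
move=> AB; have AB' j : exists b : bool, if b then A j else B.
  by case: (AB j); [exists true|exists false].
have [b bP] := fin_all_exists AB'.
have [/forallP b1|] := boolP [forall j, b j].
  by left=> j; have := bP j; rewrite b1.
by case/forallPn=> j /negPf bj; right; have := bP j; rewrite bj.
Qed.

Section Mixed.
Variables (K : fieldType) (t : nat).
Local Notation R := {mpoly K[t + t]}.
Local Notation I := (@mixed_intersection K t).
Local Notation x := (@xvar K t).
Local Notation y := (@yvar K t).
Implicit Types (J P : R -> Prop) (f : R) (j k : 'I_t).

Definition mixed_var (i : 'I_t.+1) (j : 'I_t) : 'I_(t + t) :=
  if (j < i)%N then rshift t j else lshift t j.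

Definition mixed_vars (i : 'I_t.+1) : {set 'I_(t + t)} :=
  [set mixed_var i j | j : 'I_t].

Lemma mixed_var_inj i : injective (mixed_var i).
Proof.
move=> j k /(congr1 val); rewrite /mixed_var.
by do 2!case: ifP => _ /=; move=> e; apply: val_inj => /=;
  have := ltn_ord j; have := ltn_ord k; move: e => /=; lia.
Qed.

Lemma card_mixed_vars i : #|mixed_vars i| = t.
Proof. by rewrite card_imset ?card_ord //; apply: mixed_var_inj. Qed.

Lemma mixed_gensE i j : mixed_gens K i j = 'X_(mixed_var i j).
Proof. by rewrite /mixed_gens /mixed_var; case: ifP. Qed.

Lemma mixed_var_idealE i :
  ideal_eq (ideal_gen (mixed_gens K i)) (@var_ideal K _ (mixed_vars i)).
Proof.
have gE f : ideal_gen (mixed_gens K i) f <->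
            ideal_gen (fun j => 'X_(mixed_var i j) : R) f.
  by split=> -[c ->]; exists c; apply: eq_bigr => j _; rewrite mixed_gensE.
move=> f; rewrite gE; apply: var_ideal_gen => z.
by apply/imsetP/codomP => [[j _ ->]|[j ->]]; exists j.
Qed.

Lemma mixed_is_ideal : is_ideal I.
Proof.
split=> [i|a u v Iu Iv i]; have [J0 JD] := ideal_gen_is_ideal (mixed_gens K i).
  exact: J0.
by apply: JD; [apply: Iu|apply: Iv].
Qed.

Lemma mixed_mem_mul j k : (k <= j)%N -> I (x j * y k).
Proof.
move=> le_kj i; have HJ := ideal_gen_is_ideal (mixed_gens K i).
have [lt_ki|le_ik] := ltnP k i.
  apply: idealMl => //; have := mem_ideal_gen (mixed_gens K i) k.
  by rewrite {2}/mixed_gens lt_ki.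
rewrite mulrC; apply: idealMl => //; have := mem_ideal_gen (mixed_gens K i) j.
by rewrite {2}/mixed_gens ltnNge (leq_trans le_ik le_kj).
Qed.

(** Follow y_1, y_2, ... as long as they lie in P.  If y_(m+1) does not, then
    all x_j with j > m do, since x_j y_(m+1) lies in I; so P contains
    y_1, ..., y_m, x_(m+1), ..., x_t. *)
Lemma prime_over_mixed P : is_prime_ideal P -> ideal_sub I P ->
  exists i, forall z, z \in mixed_vars i -> P 'X_z.
Proof.
move=> [_ _ PM] IP.
suff [i Pi] : exists i : 'I_t.+1, forall j, P (mixed_gens K i j).
  by exists i => _ /imsetP[j _ ->]; rewrite -mixed_gensE.
suff step m : (m <= t)%N -> (forall j, (j < m)%N -> P (y j)) \/
    exists i : 'I_t.+1, forall j, P (mixed_gens K i j).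
  have [Py|//] := step t (leqnn t).
  by exists ord_max => j; rewrite /mixed_gens ltn_ord; apply: Py.
elim: m => [|m IHm] lt_mt; first by left.
have [Py|] := IHm (ltnW lt_mt); last by right.
pose k := Ordinal lt_mt.
have xORy j : P (mixed_gens K (inord m) j) \/ P (y k).
  rewrite /mixed_gens inordK; last exact: leqW.
  have [lt_jm|le_mj] := ltnP j m; first by left; apply: Py.
  exact/PM/IP/mixed_mem_mul.
have [Pi|Pyk] := finite_or xORy; first by right; exists (inord m).
left=> j; rewrite ltnS leq_eqVlt => /predU1P[jm|]; last exact: Py.
by have -> : j = k by apply: val_inj.
Qed.

Lemma mixed_ideal_height : ideal_height I t.
Proof.
split; last first.
  move=> P m HP IP Pm; have [i Pi] := prime_over_mixed HP IP.
  by rewrite -(card_mixed_vars i); apply: prime_height_ge_card Pm.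
exists (@var_ideal K _ (mixed_vars ord0)); split; first exact: var_ideal_prime.
  by move=> f /(_ ord0) /mixed_var_idealE.
rewrite -[X in prime_height _ X](card_mixed_vars ord0).
exact: var_ideal_height.
Qed.

(** Squaring and expanding one factor f on the generators of the i-th ideal
    shows that g f lies in J as soon as y_k f (k below i) and g x_j
    (j from i on) do.  With g = y_i this proves y_i f in J for every i in turn,
    and finally f in J with g = 1 and the last ideal, which involves no x. *)
Lemma sub_mixed_radical J : is_ideal J -> (forall f n, J (f ^+ n) -> J f) ->
  (forall j k, (k <= j)%N -> J (x j * y k)) -> ideal_sub I J.
Proof.
move=> HJ rJ Jxy f If.
have step (i : 'I_t.+1) g : (forall k, (k < i)%N -> J (y k * f)) ->
    (forall j, (i <= j)%N -> J (g * x j)) -> J (g * f).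
  move=> Jyf Jgx; apply: (rJ _ 2%N).
  have -> : (g * f) ^+ 2 = g * (g * f * f) by ring.
  apply: idealMl => //; have [c fE] := If i.
  rewrite [X in _ * X]fE mulr_sumr; apply: ideal_sum => // j _.
  rewrite /mixed_gens; case: ltnP => [lt_ji|le_ij].
    have -> : g * f * (c j * y j) = g * c j * (y j * f) by ring.
    by apply: idealMl => //; apply: Jyf.
  have -> : g * f * (c j * x j) = f * c j * (g * x j) by ring.
  by apply: idealMl => //; apply: Jgx.
have Jyf m (k : 'I_t) : (k < m)%N -> J (y k * f).
  elim: m k => // m IHm k; rewrite ltnS => le_km.
  have kE : (inord k : 'I_t.+1) = k :> nat by rewrite inordK // ltnS ltnW.
  apply: (step (inord k)); rewrite kE.
  - by move=> j lt_jk; apply/IHm/(leq_trans lt_jk).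
  - by move=> j le_kj; rewrite mulrC; apply: Jxy.
rewrite -[f]mul1r; apply: (step ord_max) => [k lt_kt|j]; first exact: Jyf lt_kt.
by rewrite leqNgt ltn_ord.
Qed.

(** * The arithmetical rank of the mixed ideal *)

Definition diagonal_sum (d : 'I_t) : R :=
  \sum_(p : 'I_t * 'I_t | p.1 == (p.2 + d)%N :> nat) x p.1 * y p.2.

Lemma diagonal_sums_generate : generates_up_to_radical diagonal_sum I.
Proof.
have HJ := radical_is_ideal (ideal_gen_is_ideal diagonal_sum).
set J := radical (ideal_gen diagonal_sum) in HJ.
have rJ f n : J (f ^+ n) -> J f by apply: radical_idem.
move=> f; split; last first.
  apply: radical_mono; apply: ideal_gen_min; first exact: mixed_is_ideal.
  move=> d; apply: ideal_sum; first exact: mixed_is_ideal.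
  by move=> p /eqP pE; apply: mixed_mem_mul; rewrite pE leq_addr.
move=> [n Ifn]; apply: (rJ _ n); move: Ifn; apply: sub_mixed_radical => //.
(* Induction on the diagonals, from d = t - 1 (one product) down to d = 0. *)
suff step m j k : (k <= j)%N -> (t <= j - k + m)%N -> J (x j * y k).
  by move=> j k le_kj; apply: (step t); rewrite ?leq_addl.
elim: m j k => [|m IHm] j k le_kj; first by have := ltn_ord j; lia.
move=> le_t; have lt_dt : (j - k < t)%N by have := ltn_ord j; lia.
pose d := Ordinal lt_dt; apply: (rJ _ 2%N).
have Jd : J (diagonal_sum d) by apply/sub_radical/mem_ideal_gen.
set u := x j * y k.
have -> : u ^+ 2 = u * diagonal_sum d -
    \sum_(p : 'I_t * 'I_t | (p.1 == (p.2 + d)%N :> nat) && (p != (j, k)))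
       u * (x p.1 * y p.2).
  rewrite /diagonal_sum (bigD1 (j, k)) /=; last by rewrite subnKC.
  by rewrite mulrDr mulr_sumr addrK expr2.
apply: idealB => //; first exact: idealMl.
apply: ideal_sum => // -[j' k'] /= /andP[/eqP j'E neq_p].
have neq_k : k' != k :> nat.
  apply: contraNneq neq_p => eq_k.
  rewrite xpair_eqE -!val_eqE /= eq_k eqxx andbT.
  by rewrite j'E eq_k subnKC.
case: (ltngtP k' k) neq_k => // [lt_k|lt_k] _.
- have -> : u * (x j' * y k') = x j' * y k * (x j * y k') by rewrite /u; ring.
  by apply: idealMl => //; apply: IHm; lia.
- have -> : u * (x j' * y k') = x j * y k' * (x j' * y k) by rewrite /u; ring.
  by apply: idealMl => //; apply: IHm; rewrite j'E; lia.
Qed.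

(** Inverting the y_j would localize I at (x_1, ..., x_t); evaluating them at 1
    is enough for counting generators and stays over K. *)
Definition set_y_to_1 : (t + t).-tuple {mpoly K[t]} :=
  [tuple if split z is inl j then 'X_j else 1 | z < t + t].

Lemma set_y_to_1_x j : x j \mPo set_y_to_1 = 'X_j.
Proof.
by rewrite comp_mpolyXU -tnth_nth tnth_mktuple (unsplitK (inl j)).
Qed.

Lemma set_y_to_1_y j : y j \mPo set_y_to_1 = 1.
Proof.
by rewrite comp_mpolyXU -tnth_nth tnth_mktuple (unsplitK (inr j)).
Qed.

Lemma num_gens_mixed_ge s (g : 'I_s -> R) :
  generates_up_to_radical g I -> (t <= s)%N.
Proof.
move=> gI.
apply: (@num_gens_irrelevant_ge K t s (fun i => g i \mPo set_y_to_1)) => i.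
  have [n Ign] : radical I (g i) by apply/gI/sub_radical/mem_ideal_gen.
  have [c gE] := Ign ord0.
  have : ((g i ^+ n) \mPo set_y_to_1)@_0 = 0.
    rewrite gE (linear_sum (comp_mpoly set_y_to_1)) rmorph_sum big1 // => j _.
    rewrite /mixed_gens /= rmorphM /= set_y_to_1_x rmorphM /= mcoeffX.
    by rewrite mnm1_eq0 mulr0.
  by rewrite !rmorphXn /= => /eqP; rewrite expf_eq0 => /andP[_ /eqP].
have [n [c gE]] : radical (ideal_gen g) (x i * y i).
  exact/gI/sub_radical/mixed_mem_mul.
exists n, (fun j : 'I_s => c j \mPo set_y_to_1).
have := congr1 (comp_mpoly set_y_to_1) gE.
rewrite rmorphXn rmorphM /= set_y_to_1_x set_y_to_1_y mulr1 => ->.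
rewrite (linear_sum (comp_mpoly set_y_to_1)).
by apply: eq_bigr => j _; rewrite rmorphM.
Qed.

End Mixed.

Theorem corollary2 (K : fieldType) (t : nat) (ht : (1 <= t)%N) :
  set_theoretic_complete_intersection (@mixed_intersection K t).
Proof.
split; first exact: mixed_is_ideal.
exists t; split; first exact: mixed_ideal_height.
split; first by exists (@diagonal_sum K t); apply: diagonal_sums_generate.
exact: num_gens_mixed_ge.
Qed.
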